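(* Let $S(t)=\{p_1(t),\dots,p_n(t)\}$, $n\ge 2$, be a zero cluster at $t=0$. Then the Voronoi cell $V(p_i(0))$ has positive area if and only if $p_i$ is a vertex of the direction hull $DH(S(0))$ of $S(t)$ at $t=0$.
   Context: A polynomial site is a pair $p(t)=(p(t)_x,p(t)_y)\in\mathbb{R}[t]^2$; sites are distinct if they are distinct as elements of $\mathbb{R}[t]^2$. The ruling sign of a nonzero polynomial $f\in\mathbb{R}[t]$ is the sign of the coefficient of its lowest degree term. For sites $u,v,w$ let $D_{u,v,w}(t)=\det\begin{pmatrix}1&u_x&u_y\\1&v_x&v_y\\1&w_x&w_y\end{pmatrix}\in\mathbb{R}[t]$. The three sites are collinear if $D_{u,v,w}$ is the zero polynomial; otherwise $w$ is on the left (resp. right) of the line $l_{uv}(t)$ at $t=0$ if the ruling sign of $D_{u,v,w}$ is $+1$ (resp. $-1$). Four sites are cocircular if the $4\times4$ determinant with rows $(q_x,q_y,q_x^2+q_y^2,1)$, for $q$ running over the four sites, is the zero polynomial. A set of distinct polynomial sites is in general position at $t=0$ if no three sites are collinear and no four sites are cocircular. A zero cluster at $t=0$ is a set $S(t)$ of distinct polynomial sites in general position at $t=0$ with $p_i(0)=(0,0)$ for all $i$. The direction $\phi_{uv}\in\mathbb{R}/2\pi\mathbb{Z}$ of distinct sites $u,v$ at $t=0$ is defined by $(\cos\phi_{uv},\sin\phi_{uv})=\lim_{t\downarrow0}\frac{v(t)-u(t)}{\|v(t)-u(t)\|}$. The combinatorial convex hull $cCH(S(t))$ at $t=0$ is the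 directed graph with an edge $i\to j$ whenever all sites $p_k(t)$, $k\ne i,j$, are on the right of $l_{p_ip_j}(t)$ at $t=0$; its vertices are the labels occurring in such edges. It is a directed circuit. A vertex $v$ with incoming edge $u\to v$ and outgoing edge $v\to w$ is a corner site if $\phi_{uv}\neq\phi_{vw}$. The vertices of the direction hull $DH(S(0))$ are exactly the corner sites. Voronoi cell at $t=0$: for $i\neq j$ let $vh(p_i,p_j)=\{z\in\mathbb{R}^2: (\cos\phi_{p_ip_j},\sin\phi_{p_ip_j})\cdot (z-\tfrac12(p_i(0)+p_j(0)))\le 0\}$, and $V(p_i(0))=\bigcap_{j\ne i}vh(p_i,p_j)$. *)

(* Defs.v *)
From HB Require Import structures.
From mathcomp Require Import all_boot all_order all_algebra.
From mathcomp Require Import all_classical all_reals all_analysis.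
Set Implicit Arguments.
Unset Strict Implicit.
Unset Printing Implicit Defensive.
Import Order.TTheory GRing.Theory Num.Theory numFieldNormedType.Exports.
Local Open Scope classical_set_scope.
Local Open Scope ring_scope.

Section Sites.
Context {R : realType}.

Definition site := ({poly R} * {poly R})%type.

Implicit Types (f : {poly R}) (u v w q : site).

Definition site_at q (t : R) : R * R := (q.1.[t], q.2.[t]).

(* Coefficient lists start at degree 0. *)
Definition ruling_sign f : R := Num.sg f`_(find (fun c => c != 0) f).

Definition mx_of_rows n (rows : seq (seq {poly R})) : 'M[{poly R}]_n :=
  \matrix_(i, j) (nth [::] rows i)`_j.

Definition orient_poly u v w : {poly R} :=
  \det (mx_of_rows 3 [:: [:: 1; u.1; u.2]; [:: 1; v.1; v.2]; [:: 1; w.1; w.2]]).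

Definition collinear u v w := orient_poly u v w = 0.

Definition on_right u v w := ruling_sign (orient_poly u v w) = -1.

Definition circle_row q : seq {poly R} := [:: q.1; q.2; q.1 ^+ 2 + q.2 ^+ 2; 1].

Definition cocircular q1 q2 q3 q4 :=
  \det (mx_of_rows 4 [seq circle_row q | q <- [:: q1; q2; q3; q4]]) = 0.

(* Euclidean norm; the library norm on a product is the sup norm. *)
Definition enorm (z : R * R) : R := Num.sqrt (z.1 ^+ 2 + z.2 ^+ 2).

Definition unit_difference u v (t : R) : R * R :=
  let d := site_at v t - site_at u t in (d.1 / enorm d, d.2 / enorm d).

(* An element of R/2piZ is encoded by its representative in [0, 2pi[, so
   equality of directions is equality in R/2piZ. Junk value when u = v. *)
Definition direction u v : R :=
  get [set phi : R | 0 <= phi < pi *+ 2 /\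
    unit_difference u v t @[t --> 0^'+] --> (cos phi, sin phi)].

Section Families.
Variable n : nat.
Implicit Types (p : 'I_n -> site) (i j k : 'I_n).

Definition general_position p :=
  (forall i j k, uniq [:: i; j; k] -> ~ collinear (p i) (p j) (p k)) /\
  (forall i j k l, uniq [:: i; j; k; l] ->
     ~ cocircular (p i) (p j) (p k) (p l)).

Definition zero_cluster p :=
  [/\ injective p, general_position p & forall i, site_at (p i) 0 = (0, 0)].

Definition cCH_edge p i j :=
  i <> j /\ forall k, k <> i -> k <> j -> on_right (p i) (p j) (p k).

Definition corner_site p (v : 'I_n) :=
  exists u w : 'I_n, [/\ cCH_edge p u v, cCH_edge p v w &
    direction (p u) (p v) <> direction (p v) (p w)].

Definition DH_vertices p : set 'I_n := [set i | corner_site p i].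

Definition vh p i j : set (R * R) :=
  [set z | let phi := direction (p i) (p j) in
           let m := 2^-1 *: (site_at (p i) 0 + site_at (p j) 0) in
           cos phi * (z - m).1 + sin phi * (z - m).2 <= 0].

Definition voronoi_cell p i : set (R * R) :=
  \bigcap_(j in [set j | j <> i]) vh p i j.

End Families.

Definition area : set (R * R) -> \bar R :=
  (@lebesgue_measure R \x @lebesgue_measure R)%E.

End Sites.

Arguments site : clear implicits.

(* Main.v *)
(* Write d_ij for the limiting unit direction from p_i to p_j. All sites sit at
   the origin, so the Voronoi cell of p_i is the cone { z | d_ij . z <= 0 for
   all j <> i }, which has positive area iff some z makes all these inequalities
   strict (the bounding lines are null sets).
   Given such a z, at a small fixed t > 0 at which every orientation
   determinant has its ruling sign, all other sites lie in an open half-plane at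
   p_i, so p_i is extreme; its hull neighbours u, w satisfy d_ui . z > 0 and
   d_iw . z < 0, hence the two directions differ.
   Conversely, if u -> i -> w is a corner, z = - (d_iu + d_iw) works: for small
   t > 0 every p_j - p_i is a positive combination of p_u - p_i and p_w - p_i,
   whence (d_iu + d_iw) . d_ij >= 1 + d_iu . d_iw > 0 in the limit. *)
Require Import Defs.
From mathcomp Require Import all_boot all_order all_algebra.
From mathcomp Require Import all_classical all_reals all_analysis.
From mathcomp Require Import ring lra.
Import Order.TTheory GRing.Theory Num.Theory numFieldNormedType.Exports.
Local Open Scope classical_set_scope.
Local Open Scope ring_scope.

(** * Dot and cross products in the plane *)

Definition dot {R : realType} (a b : R * R) : R := a.1 * b.1 + a.2 * b.2.
Definition cross {R : realType} (a b : R * R) : R := a.1 * b.2 - a.2 * b.1.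

Lemma dotZl {R : realType} (c : R) (a b : R * R) : dot (c *: a) b = c * dot a b.
Proof. by rewrite /dot /= mulrDr !mulrA. Qed.

Lemma dotDl {R : realType} (a b c : R * R) : dot (a + b) c = dot a c + dot b c.
Proof. by rewrite /dot /=; ring. Qed.

Lemma dotNr {R : realType} (a b : R * R) : dot a (- b) = - dot a b.
Proof. by rewrite /dot /=; ring. Qed.

Lemma dotC {R : realType} (a b : R * R) : dot a b = dot b a.
Proof. by rewrite /dot mulrC [X in _ + X]mulrC. Qed.

Lemma crossZ {R : realType} (c d : R) (a b : R * R) :
  cross (c *: a) (d *: b) = (c * d) * cross a b.
Proof. by rewrite /cross /= /GRing.scale /=; ring. Qed.

(* Cramer's rule c q = A y + B x, with c = cross y x, A = cross q x and
   B = cross y q all negative, gives c = - |A y + B x| >= A + B. *)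
Lemma dot_bisector_ge {R : realType} (x y q : R * R) :
  dot x x = 1 -> dot y y = 1 -> dot q q = 1 ->
  cross y q < 0 -> cross q x < 0 -> cross y x < 0 ->
  1 + dot x y <= dot (x + y) q.
Proof.
case: x y q => [x1 x2] [y1 y2] [q1 q2]; rewrite /dot /cross /= => xx yy qq.
set B := _ - _ => B0; set A := _ - _ => A0; set c := _ - _ => c0.
set s := x1 * y1 + x2 * y2.
have s_le1 : s <= 1.
  have : 0 <= (x1 - y1) ^+ 2 + (x2 - y2) ^+ 2 by rewrite addr_ge0 ?sqr_ge0.
  by rewrite /s; lra.
have s_geN1 : -1 <= s.
  have : 0 <= (x1 + y1) ^+ 2 + (x2 + y2) ^+ 2 by rewrite addr_ge0 ?sqr_ge0.
  by rewrite /s; lra.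
have q1E : c * q1 = A * y1 + B * x1 by rewrite /c /A /B; ring.
have q2E : c * q2 = A * y2 + B * x2 by rewrite /c /A /B; ring.
clearbody A B c.
(* Sum of the squares of the two Cramer identities, using that [x], [y], [q] are unit vectors. *)
have cE : c ^+ 2 = A ^+ 2 + B ^+ 2 + A * B * s *+ 2.
  rewrite -[LHS]mulr1 -qq.
  have -> : c ^+ 2 * (q1 * q1 + q2 * q2) = (c * q1) ^+ 2 + (c * q2) ^+ 2 by ring.
  rewrite q1E q2E -[in RHS](mulr1 (A ^+ 2)) -[in RHS](mulr1 (B ^+ 2)) -{1}yy -xx /s.
  by ring.
have AB0 : 0 < A * B by rewrite nmulr_rgt0.
(* Both sides are negative, so it is enough that c^2 <= (A + B)^2, which holds because A B > 0 and s
   <= 1. *)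
have ABc : A + B <= c.
  rewrite -lerN2 -(@ler_pXn2r _ 2) ?nnegrE; [|by []|by lra..].
  rewrite !sqrrN cE sqrrD.
  have : A * B * s <= A * B * 1 by rewrite ler_pM2l.
  by rewrite mulr1; lra.
(* Multiplying by c < 0 reverses the goal into (A + B)(1 + s) <= c (1 + s), where 1 + s >= 0. *)
rewrite -(@ler_nM2l _ c)//.
have -> : c * ((x1 + y1) * q1 + (x2 + y2) * q2) = (A + B) * (1 + s).
  have -> : c * ((x1 + y1) * q1 + (x2 + y2) * q2) =
    (x1 + y1) * (c * q1) + (x2 + y2) * (c * q2) by ring.
  rewrite q1E q2E /s.
  transitivity (A * (y1 * y1 + y2 * y2) + B * (x1 * x1 + x2 * x2) +
    (A + B) * (x1 * y1 + x2 * y2)); first by ring.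
  by rewrite xx yy; ring.
by rewrite ler_wpM2r//; lra.
Qed.

(** * Signs of polynomials just after 0, the Euclidean norm, and angles of unit vectors *)

Section GermsAtZero.
Context {R : realType}.
Implicit Types (f a b : {poly R}) (u v w : site R).

Lemma polyMXn_drop f m : (forall k, (k < m)%N -> f`_k = 0) ->
  f = drop_poly m f * 'X^m.
Proof.
move=> f0; rewrite -[LHS](poly_take_drop m) [X in X + _](_ : _ = 0) ?add0r//.
by apply/polyP => k; rewrite coef_take_poly coef0; case: ifP => // /f0.
Qed.

Lemma has_coef_neq0 f : f != 0 -> has (fun c => c != 0) f.
Proof.
move=> f_neq0; apply/hasP; exists (lead_coef f); last by rewrite lead_coef_eq0.
by rewrite lead_coefE mem_nth// ltn_predL size_poly_gt0.
Qed.

(** The zero polynomial gets sign 0 because its empty coefficient list is read with default 0. This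
    turns non-collinearity into a nonzero sign. *)
Lemma ruling_sign_eq0 f : (ruling_sign f == 0) = (f == 0).
Proof.
have [->|/has_coef_neq0 hasf] := eqVneq f 0.
  by rewrite /ruling_sign polyseq0 sgr0 eqxx.
by rewrite /ruling_sign sgr_eq0 (negPf (nth_find 0 hasf)).
Qed.

(** Write f = g X^m with g(0) the lowest nonzero coefficient: for t > 0 the factor t^m is positive,
    and g(t) keeps the sign of g(0) near 0. *)
Lemma near_ruling_sign f : \forall t \near 0^'+, Num.sg f.[t] = ruling_sign f.
Proof.
have [->|f_neq0] := eqVneq f 0.
  by near=> t; rewrite /ruling_sign polyseq0 horner0 sgr0.
have hasf := has_coef_neq0 _ f_neq0.
rewrite /ruling_sign; set m := find _ _.
have fm : f`_m != 0 := nth_find 0 hasf.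
have fE : f = drop_poly m f * 'X^m.
  by apply: polyMXn_drop => k km; apply/eqP/negbFE/(before_find 0 km).
set g := drop_poly m f in fE.
have g0 : g.[0] = f`_m by rewrite horner_coef0 coef_drop_poly.
have cg : g.[t] @[t --> 0^'+] --> f`_m.
  by rewrite -g0; apply: cvg_at_right_filter; exact: continuous_horner.
have sgE t : 0 < t -> Num.sg f.[t] = Num.sg g.[t].
  by move=> t0; rewrite fE hornerM hornerXn sgrM [X in _ * X]gtr0_sg ?exprn_gt0// mulr1.
have [fm0|fm0|fm0] := ltgtP f`_m 0; last by rewrite fm0 eqxx in fm.
- have gt0 : \forall t \near 0^'+, g.[t] < 0 by exact: (cvgr_lt f`_m).
  by near=> t; rewrite sgE// !ltr0_sg//; near: t.
- have gt0 : \forall t \near 0^'+, 0 < g.[t] by exact: (cvgr_gt f`_m).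
  by near=> t; rewrite sgE// !gtr0_sg//; near: t.
Unshelve. all: by end_near. Qed.

Lemma orient_polyE u v w : orient_poly u v w =
  (v.1 - u.1) * (w.2 - u.2) - (v.2 - u.2) * (w.1 - u.1).
Proof.
rewrite /orient_poly (expand_det_row _ ord0) !big_ord_recl big_ord0 /cofactor.
rewrite !(expand_det_row _ ord0) !big_ord_recl !big_ord0 /cofactor !det_mx11 !mxE /=.
by rewrite /bump /= ; ring.
Qed.

Lemma horner_orient u v w t : (orient_poly u v w).[t] =
  cross (site_at v t - site_at u t) (site_at w t - site_at u t).
Proof. by rewrite orient_polyE !hornerE. Qed.

Lemma orient_poly_rot u v w : orient_poly u v w = orient_poly v w u.
Proof. by rewrite !orient_polyE; ring. Qed.

Lemma enorm_gt0 (d : R * R) : d != 0 -> 0 < enorm d.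
Proof.
move=> d0; rewrite sqrtr_gt0 lt_neqAle addr_ge0 ?sqr_ge0// andbT eq_sym.
by rewrite paddr_eq0 ?sqr_ge0// !sqrf_eq0; case: d d0.
Qed.

Lemma enormN (d : R * R) : enorm (- d) = enorm d.
Proof. by rewrite /enorm /= !sqrrN. Qed.

Lemma sqr_enorm (d : R * R) : enorm d ^+ 2 = d.1 ^+ 2 + d.2 ^+ 2.
Proof. by rewrite sqr_sqrtr// addr_ge0// sqr_ge0. Qed.

Lemma enorm_scale (c : R) (d : R * R) : 0 <= c -> enorm (d.1 * c, d.2 * c) = enorm d * c.
Proof.
move=> c0; rewrite /enorm /= !exprMn -mulrDl sqrtrM ?addr_ge0 ?sqr_ge0//.
by rewrite sqrtr_sqr ger0_norm.
Qed.

(** The angle is acos x on the upper half circle and 2 pi - acos x on the lower one. *)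
Lemma unit_vectorP (e : R * R) : dot e e = 1 ->
  exists2 phi, 0 <= phi < pi *+ 2 & e = (cos phi, sin phi).
Proof.
case: e => x y; rewrite /dot /= => xy1.
have x1 : -1 <= x <= 1.
  rewrite -ler_norml -(@ler_pXn2r _ 2) ?nnegrE//.
  rewrite real_normK ?num_real// expr1n; have := sqr_ge0 y.
  by rewrite !expr2; lra.
have sE : sin (acos x) = `|y|.
  by rewrite sin_acos// -sqrtr_sqr; congr Num.sqrt; rewrite !expr2; lra.
have xcos : cos (acos x) = x by rewrite acosK// in_itv.
have pi0 := pi_gt0 R.
have a0 := acos_ge0 x1; have api := acos_lepi x1.
have [y0|y0] := leP 0 y.
  exists (acos x); first by rewrite a0 /= mulr2n; lra.
  by rewrite xcos sE ger0_norm.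
(* Keeps 2 pi - acos x strictly below 2 pi: acos x = 0 would give |y| = sin 0 = 0, while y < 0. *)
have a_gt0 : 0 < acos x.
  rewrite lt_neqAle a0 andbT; apply/eqP => a0'.
  by move: sE; rewrite -a0' sin0 ltr0_norm//; lra.
exists (pi *+ 2 - acos x); first by rewrite mulr2n; lra.
by rewrite cosB sinB cos2pi sin2pi xcos sE ltr0_norm//; congr pair; ring.
Qed.

End GermsAtZero.

(** * Existence and symmetry of limiting directions *)

Section Directions.
Context {R : realType}.
Implicit Types (f a b : {poly R}) (u v w : site R) (z : R * R).

Definition unit_direction u v : R * R := (cos (direction u v), sin (direction u v)).

Lemma dot_unit_direction u v : dot (unit_direction u v) (unit_direction u v) = 1.
Proof. by rewrite /dot /= -!expr2 cos2Dsin2. Qed.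

(** Take for m the least degree at which [a] or [b] has a nonzero coefficient; after division by X^m
    that coefficient is the value at 0. *)
Lemma poly_pair_factorX a b : (a, b) != 0 -> exists m a' b',
  [/\ a = a' * 'X^m, b = b' * 'X^m & (a'.[0], b'.[0]) != 0 :> R * R].
Proof.
move=> ab0.
have exm : exists m, (a`_m != 0) || (b`_m != 0).
  have [a0|a0] := eqVneq a 0.
    have b0 : b != 0 by move: ab0; rewrite a0; apply: contraNneq => ->.
    by exists (size b).-1; rewrite -lead_coefE lead_coef_eq0 b0 orbT.
  by exists (size a).-1; rewrite -lead_coefE lead_coef_eq0 a0.
case: (ex_minnP exm) => m m0 mmin; exists m, (drop_poly m a), (drop_poly m b).
have low k : (k < m)%N -> a`_k = 0 /\ b`_k = 0.
  by rewrite ltnNge => km; split; apply/eqP; apply: contraNT km => h;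
    apply: mmin; rewrite h ?orbT.
split; [by apply: polyMXn_drop => k /low[]|by apply: polyMXn_drop => k /low[]|].
rewrite !horner_coef0 !coef_drop_poly.
by apply/negP => /eqP[am bm]; move: m0; rewrite am bm eqxx.
Qed.

(** The common factor t^m of both coordinates of v - u cancels under normalization, leaving a
    quotient that is continuous at 0. *)
Lemma unit_difference_germ u v : u <> v -> exists e : R * R, [/\ dot e e = 1,
  unit_difference u v t @[t --> 0^'+] --> e &
  \forall t \near 0^'+, site_at v t - site_at u t != 0].
Proof.
move=> uv; have [|m [a [b [aE bE ab0]]]] :=
  @poly_pair_factorX (v.1 - u.1) (v.2 - u.2).
  apply/negP => /eqP[/eqP + /eqP]; rewrite !subr_eq0 => /eqP h1 /eqP h2.
  by apply: uv; case: u v h1 h2 => [? ?] [? ?] /= -> ->.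
have dE t : site_at v t - site_at u t = (a.[t] * t ^+ m, b.[t] * t ^+ m).
  by rewrite /site_at; congr pair; rewrite /= -hornerN -hornerD ?aE ?bE hornerM hornerXn.
pose g t : R * R := (a.[t], b.[t]).
have cvg_a : a.[t] @[t --> 0^'+] --> a.[0].
  by apply: cvg_at_right_filter; exact: continuous_horner.
have cvg_b : b.[t] @[t --> 0^'+] --> b.[0].
  by apply: cvg_at_right_filter; exact: continuous_horner.
have cvg_n : enorm (g t) @[t --> 0^'+] --> enorm (g 0).
  apply: (continuous_cvg _ (@sqrt_continuous R _)).
  by apply: cvgD; rewrite /= ?expr2; exact: cvgM.
have n0 : 0 < enorm (g 0) by exact: enorm_gt0.
have udE : \forall t \near 0^'+,
    (a.[t] / enorm (g t), b.[t] / enorm (g t)) = unit_difference u v t.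
  near=> t.
  have t0 : 0 < t by near: t; exact: nbhs_right_gt.
  rewrite /unit_difference dE (enorm_scale _ (g t)) ?exprn_ge0 ?ltW//=.
  have tm0 : t ^+ m != 0 by rewrite expf_neq0// gt_eqF.
  by congr pair; rewrite -mulf_div divff// mulr1.
exists (a.[0] / enorm (g 0), b.[0] / enorm (g 0)); split.
- rewrite /dot /=.
  transitivity ((a.[0] ^+ 2 + b.[0] ^+ 2) / enorm (g 0) ^+ 2).
    by field; rewrite gt_eqF.
  by rewrite -(sqr_enorm (g 0)) divff// expf_neq0// gt_eqF.
- apply: cvg_trans; first exact: near_eq_cvg udE.
  have nV : (enorm (g t))^-1 @[t --> 0^'+] --> (enorm (g 0))^-1.
    by apply: cvgV => //; rewrite gt_eqF.
  exact: cvg_pair (cvgM cvg_a nV) (cvgM cvg_b nV).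
- near=> t.
  have t0 : 0 < t by near: t; exact: nbhs_right_gt.
  have : 0 < enorm (g t) by near: t; exact: (cvgr_gt (enorm (g 0))).
  rewrite dE; apply: contraTN => /eqP[/eqP + /eqP].
  rewrite !mulf_eq0 !expf_eq0 (gt_eqF t0) !andbF !orbF => /eqP a0 /eqP b0.
  by rewrite /enorm/= a0 b0 expr0n addr0 sqrtr0 ltxx.
Unshelve. all: by end_near. Qed.

(** The limit exists and is a unit vector, so the set under [get] is inhabited and [direction] is
    not the junk value. *)
Lemma cvg_unit_difference {u v} : u <> v ->
  unit_difference u v t @[t --> 0^'+] --> unit_direction u v.
Proof.
move=> /unit_difference_germ[e [/unit_vectorP[phi phi2pi ->] cvge _]].
rewrite /unit_direction /direction.
suff [] : [set phi : R | 0 <= phi < pi *+ 2 /\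
  unit_difference u v t @[t --> 0^'+] --> (cos phi, sin phi)] (direction u v) by [].
by apply: getPex; exists phi.
Qed.

Lemma cvg_unit_difference1 {u v} : u <> v ->
  (unit_difference u v t).1 @[t --> 0^'+] --> (unit_direction u v).1.
Proof. by move=> /cvg_unit_difference h; apply: (cvg_comp _ _ h); exact: cvg_fst. Qed.

Lemma cvg_unit_difference2 {u v} : u <> v ->
  (unit_difference u v t).2 @[t --> 0^'+] --> (unit_direction u v).2.
Proof. by move=> /cvg_unit_difference h; apply: (cvg_comp _ _ h); exact: cvg_snd. Qed.

Lemma near_site_neq {u v} : u <> v -> \forall t \near 0^'+, site_at v t - site_at u t != 0.
Proof. by move=> /unit_difference_germ[e []]. Qed.

Lemma unit_differenceE u v t : unit_difference u v t =
  (enorm (site_at v t - site_at u t))^-1 *: (site_at v t - site_at u t).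
Proof. by rewrite /unit_difference; congr pair; rewrite mulrC. Qed.

Lemma unit_differenceC u v t : unit_difference u v t = - unit_difference v u t.
Proof.
rewrite !unit_differenceE -scalerN opprB; congr (_^-1 *: _).
by rewrite -enormN opprB.
Qed.

Lemma unit_directionC {u v} : u <> v -> unit_direction v u = - unit_direction u v.
Proof.
move=> uv; have vu : v <> u by exact: nesym.
apply: (cvg_unique (@norm_hausdorff R (R * R)%type) (cvg_unit_difference vu)).
rewrite (_ : unit_difference v u = fun t => - unit_difference u v t).
  exact: cvgN (cvg_unit_difference uv).
by apply/funext => t; exact: unit_differenceC.
Qed.

(* [direction] is the [get] of a set that depends only on the limit of
   [unit_difference], so no injectivity of (cos, sin) is needed. *)
Lemma eq_direction u v w x : u <> v -> w <> x ->
  unit_direction u v = unit_direction w x -> direction u v = direction w x.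
Proof.
move=> uv wx e; rewrite /direction; congr get.
apply/seteqP; split => phi /= [-> h]; split => //.
- rewrite -(cvg_unique (@norm_hausdorff R (R * R)%type) (cvg_unit_difference uv) h)// e.
  exact: cvg_unit_difference.
- rewrite -(cvg_unique (@norm_hausdorff R (R * R)%type) (cvg_unit_difference wx) h)// -e.
  exact: cvg_unit_difference.
Qed.

End Directions.

(** * Planar measure of a finite intersection of half-planes *)

Section Area.
Context {R : realType}.
Implicit Types (a z : R * R) (A : set (R * R)).

Local Notation mu2 := (@lebesgue_measure R \x @lebesgue_measure R)%E.

Lemma measurable_half_plane a : measurable [set z : R * R | dot a z <= 0].
Proof.
rewrite -[X in measurable X]setTI; apply: measurable_fun_le => //.
by apply: measurable_realfun.measurable_funD; apply: measurable_realfun.measurable_funM => //.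
Qed.

(** A vertical line is the product of a point and R; any other line has singleton vertical
    sections. *)
Lemma negligible_line a : a != 0 -> mu2.-negligible [set z : R * R | dot a z = 0].
Proof.
case: a => a1 a2 a0.
have mline : measurable [set z : R * R | dot (a1, a2) z = 0].
  have -> : [set z : R * R | dot (a1, a2) z = 0] =
      [set z | dot (a1, a2) z <= 0] `&` [set z | dot (- a1, - a2) z <= 0].
    apply/seteqP; split => z; rewrite /dot/= !mulNr.
      by move=> ?; split; lra.
    by move=> [? ?]; lra.
  by apply: measurableI; exact: measurable_half_plane.
apply/negligibleP => //; have [a20|a20] := eqVneq a2 0.
  have a10 : a1 != 0 by move: a0; rewrite a20; apply: contraNneq => ->.
  have -> : [set z : R * R | dot (a1, a2) z = 0] = [set 0] `*` [set: R].
    apply/seteqP; split => -[x y]; rewrite /dot/= a20 mul0r addr0.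
      by move/eqP; rewrite mulf_eq0 (negPf a10) => /eqP.
    by move=> [-> _]; rewrite mulr0.
  transitivity (lebesgue_measure [set (0 : R)%R] * lebesgue_measure [set: R])%E.
    exact: product_measure1E.
  by rewrite lebesgue_measure_set1 mul0e.
apply: integral0_eq => x _ /=.
rewrite (_ : xsection _ _ = [set - a1 * x / a2]) ?lebesgue_measure_set1//.
apply/seteqP; split => y; rewrite /xsection /dot /= ?in_setE /=.
  by move=> h; apply/(mulIf a20); rewrite divfK//; lra.
by move=> ->; field.
Qed.

Lemma area_gt0_of_square A z e : measurable A -> 0 < e ->
  (forall x y, `|x - z.1| < e -> `|y - z.2| < e -> A (x, y)) -> (0 < area A)%E.
Proof.
move=> mA e0 subA; pose I (c : R) : set R := [set` `]c - e, c + e[].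
apply: (@lt_le_trans _ _ (mu2 (I z.1 `*` I z.2))).
  have -> : mu2 (I z.1 `*` I z.2) = (lebesgue_measure (I z.1) * lebesgue_measure (I z.2))%E.
    by apply: product_measure1E; exact: measurable_itv.
  rewrite !lebesgue_measure_itv/= !lte_fin.
  have lt c : c - e < c + e by lra.
  by rewrite !lt -!EFinB -EFinM lte_fin mulr_gt0//; lra.
apply: le_measure; rewrite ?inE//; first by apply: measurableX; exact: measurable_itv.
by move=> [x y]; rewrite /I /= !in_itv/= => -[hx hy]; apply: subA; rewrite ltr_distl.
Qed.

Variable I : finType.

(** Without a strict solution, every point of the cone lies on one of finitely many null lines.
    Conversely, finitely many strict inequalities persist on a small square. *)
Lemma area_cone_gt0P (P : {pred I}) (d : I -> R * R) : (forall j, P j -> d j != 0) ->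
  (0 < area (\bigcap_(j in [set j | P j]) [set z | (dot (d j) z <= 0)%R]))%E <->
  exists z, forall j, P j -> dot (d j) z < 0.
Proof.
move=> d0; set C := \bigcap_(j in _) _.
have mC : measurable C.
  by apply: fin_bigcap_measurable => // j _; exact: measurable_half_plane.
split=> [C0|[z zneg]].
  apply: contrapT => noz.
  suff nC : mu2.-negligible C.
    have C00 : mu2 C = 0%E by exact/negligibleP.
    by move: C0; rewrite /area C00 ltxx.
  (* The lines are listed along [nat] through the countable encoding of [I]; codes of no relevant
     index give the empty set. *)
  pose L (k : nat) : set (R * R) := if unpickle k is Some j then
    if P j then [set z | dot (d j) z = 0] else set0 else set0.
  apply: (negligibleS (mu := mu2) (A := \bigcup_k L k)); last first.
    apply: negligible_bigcup => k; rewrite /L; case: unpickle => [j|].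
      case: ifP => [Pj|_]; last exact: negligible_set0.
      by apply: negligible_line; exact: d0.
    exact: negligible_set0.
  move=> z Cz; apply: contrapT => nLz; apply: noz; exists z => j Pj.
  rewrite lt_neqAle (Cz j Pj) andbT; apply/eqP => dz; apply: nLz.
  by exists (pickle j); rewrite //= /L pickleK Pj.
have : \forall y \near z, forall j, P j -> dot (d j) y < 0.
  apply: (@filter_forall _ I (fun j y => P j -> dot (d j) y < 0) (nbhs z) _) => j.
  case: (boolP (P j)) => [Pj|_]; last exact: nearW.
  have h1 : y.1 @[y --> z] --> z.1 by exact: cvg_fst.
  have h2 : y.2 @[y --> z] --> z.2 by exact: cvg_snd.
  have cd : dot (d j) y @[y --> z] --> dot (d j) z.
    exact: cvgD (cvgM (cvg_cst _) h1) (cvgM (cvg_cst _) h2).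
  by apply: filterS (cvgr_lt _ cd _ (zneg _ Pj)) => y.
(* Balls of the product are squares, as [area_gt0_of_square] requires. *)
move=> /nbhs_ballP[e /= e0 ballC].
apply: (@area_gt0_of_square _ z e) => // x y hx hy j Pj /=.
by apply/ltW/ballC => //; split; rewrite /ball/= distrC.
Qed.

End Area.

(** * Corner sites and strict half-planes *)

Section Corners.
Context {R : realType}.
Implicit Types (u v w : site R) (z : R * R).

Lemma cvg_dot_unit_difference {u v} z : u <> v ->
  dot (unit_difference u v t) z @[t --> 0^'+] --> dot (unit_direction u v) z.
Proof.
by move=> uv; apply: cvgD; (apply: cvgM; last exact: cvg_cst);
  [exact: cvg_unit_difference1|exact: cvg_unit_difference2].
Qed.

Lemma near_dot_unit_difference {u v} : u <> v -> \forall t \near 0^'+,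
  dot (unit_difference u v t) (unit_difference u v t) = 1.
Proof.
move=> /near_site_neq uv; near=> t.
have /enorm_gt0 e0 : site_at v t - site_at u t != 0 by near: t.
rewrite unit_differenceE dotZl dotC dotZl /dot -!expr2 -sqr_enorm expr2.
by rewrite mulKf ?mulVf// gt_eqF.
Unshelve. all: by end_near. Qed.

Lemma near_dot_site_lt0 u v z : u <> v -> dot (unit_direction u v) z < 0 ->
  \forall t \near 0^'+, dot (site_at v t - site_at u t) z < 0.
Proof.
move=> uv uvz.
have nz := near_site_neq uv.
have lt : \forall t \near 0^'+, dot (unit_difference u v t) z < 0.
  by apply: (cvgr_lt _ _ _ uvz); exact: cvg_dot_unit_difference.
near=> t.
have : dot (unit_difference u v t) z < 0 by near: t.
rewrite unit_differenceE dotZl pmulr_rlt0// invr_gt0 enorm_gt0//.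
by near: t.
Unshelve. all: by end_near. Qed.

Lemma near_on_right u v w : on_right u v w ->
  \forall t \near 0^'+, cross (site_at v t - site_at u t) (site_at w t - site_at u t) < 0.
Proof.
move=> uvw; have rs := near_ruling_sign (orient_poly u v w); near=> t.
rewrite -horner_orient -sgr_cp0; apply/eqP.
by rewrite -uvw; near: t.
Unshelve. all: by end_near. Qed.

Lemma near_on_right_unit u v w : u <> v -> u <> w -> on_right u v w ->
  \forall t \near 0^'+, cross (unit_difference u v t) (unit_difference u w t) < 0.
Proof.
move=> uv uw /near_on_right uvw.
have nuv := near_site_neq uv; have nuw := near_site_neq uw; near=> t.
rewrite !unit_differenceE crossZ pmulr_rlt0; first by near: t.
by rewrite mulr_gt0// invr_gt0 enorm_gt0//; near: t.
Unshelve. all: by end_near. Qed.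

Variables (n : nat) (p : 'I_n -> site R) (p_inj : injective p).

Lemma site_neq {i j} : i <> j -> p i <> p j.
Proof. by move=> ij /p_inj. Qed.

(* At a small fixed t the neighbours of i on the hull are the sites where the
   slope cross z d / dot d z is maximal and minimal, d being the vector from i. *)
Lemma corner_of_half_plane i z : (1 < n)%N ->
  (forall j k l, uniq [:: j; k; l] -> ~ collinear (p j) (p k) (p l)) ->
  (forall j, j != i -> dot (unit_direction (p i) (p j)) z < 0) ->
  corner_site p i.
Proof.
move=> n1 gp zneg.
have [j0 j0i] : exists j, j != i.
  have /card_gt1P[x [y [_ _ xy]]] : (1 < #|'I_n|)%N by rewrite card_ord.
  by have [xi|xi] := eqVneq x i; [exists y; rewrite -xi eq_sym|exists x].
have near_neg j : \forall t \near 0^'+,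
    j != i -> dot (site_at (p j) t - site_at (p i) t) z < 0.
  have [->|ji] := eqVneq j i; first exact: nearW.
  apply: filterS (near_dot_site_lt0 _ _ z _ (zneg _ ji)) => //.
  by apply: site_neq; apply/nesym/eqP.
have near_sg a b c : \forall t \near 0^'+,
    Num.sg (orient_poly (p a) (p b) (p c)).[t] =
    ruling_sign (orient_poly (p a) (p b) (p c)) by exact: near_ruling_sign.
(* There are finitely many sites and triples, so a single t serves all of them. *)
have [t [negt sgt]] := filter_ex (filterI (filter_forall _ near_neg)
  (filter_forall _ (fun a => filter_forall _ (fun b => filter_forall _ (near_sg a b))))).
pose d j := site_at (p j) t - site_at (p i) t.
pose s j := cross z (d j) / dot (d j) z.
have z2 : 0 < dot z z.
  rewrite /dot lt_neqAle addr_ge0 -?expr2 ?sqr_ge0// andbT eq_sym.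
  apply/negP; rewrite paddr_eq0 ?sqr_ge0// !sqrf_eq0 => /andP[/eqP z1 /eqP z2].
  by have := negt _ j0i; rewrite /dot z1 z2 !mulr0 addr0 ltxx.
have slope_right j k : j != i -> k != i -> j != k -> s k <= s j ->
    on_right (p i) (p j) (p k).
  move=> ji ki jk skj; rewrite /on_right -sgt.
  (* General position makes the ruling sign nonzero, so at this t a weak inequality between slopes
     already gives a strict side. *)
  have nc : (orient_poly (p i) (p j) (p k)).[t] != 0.
    rewrite -sgr_eq0 sgt ruling_sign_eq0; apply/eqP/gp.
    by rewrite /= !inE !negb_or ![i == _]eq_sym ji ki jk.
  apply/eqP; rewrite sgr_cp0 lt_neqAle nc /= horner_orient -/(d j) -/(d k).
  rewrite -(@ler_pM2l _ _ z2)// mulr0.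
  have dj := negt _ ji; have dk := negt _ ki; rewrite -/(d j) -/(d k) in dj dk.
  (* Both factors [dot (d j) z] and [dot (d k) z] are negative, so the orientation has the sign of
     the slope difference. *)
  have -> : dot z z * cross (d j) (d k) = dot (d j) z * dot (d k) z * (s k - s j).
    transitivity (dot (d j) z * cross z (d k) - cross z (d j) * dot (d k) z).
      by rewrite /dot /cross; ring.
    by rewrite /s; field; rewrite !lt_eqF.
  by rewrite pmulr_rle0 ?subr_le0// nmulr_rgt0.
(* The successor [w] maximizes the slope and the predecessor [u] minimizes it; with only two sites
   they coincide. *)
case: (@arg_maxP _ _ _ j0 (fun j => j != i) s j0i) => w wi wmax.
case: (@arg_maxP _ _ _ j0 (fun j => j != i) (fun j => - s j) j0i) => u ui umin.
exists u, w; split.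
- split; first exact/eqP.
  move=> k ku ki; rewrite /on_right orient_poly_rot.
  apply: slope_right => //; [exact/eqP|exact/eqP|].
  by rewrite -lerN2; apply: umin; exact/eqP.
- split; first by apply/nesym/eqP.
  move=> k ki kw; apply: slope_right => //; [exact/eqP|by rewrite eq_sym; exact/eqP|].
  by apply: wmax; exact/eqP.
(* Equal directions would make d_iu = - d_iw, but both have negative dot product with [z]. *)
move=> ed.
have := zneg _ wi; have := zneg _ ui.
have iu : p i <> p u by apply/site_neq/nesym/eqP.
have : unit_direction (p u) (p i) = unit_direction (p i) (p w).
  by rewrite /unit_direction ed.
by rewrite (unit_directionC iu) => <-; rewrite /dot /= !mulNr; lra.
Qed.

(** The bound of [dot_bisector_ge] is applied to the unit differences at small t > 0. Being weak, it
    passes to the limit; strictness comes from 1 + x . y > 0 there. *)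
Lemma half_plane_of_corner i : corner_site p i ->
  exists z, forall j, j != i -> dot (unit_direction (p i) (p j)) z < 0.
Proof.
move=> [u [w [[ui ur] [iw wr] dneq]]].
have iu : p i <> p u by exact/site_neq/nesym.
have ipw := site_neq iw.
set x := unit_direction (p i) (p u); set y := unit_direction (p i) (p w).
have xx : dot x x = 1 by exact: dot_unit_direction.
have yy : dot y y = 1 by exact: dot_unit_direction.
(* As 2 (1 + x . y) = |x + y|^2, failure would mean x = - y, that is, equal incoming and outgoing
   directions. *)
have xy : 0 < 1 + dot x y.
  have e2 : 2 * (1 + dot x y) = (x.1 + y.1) ^+ 2 + (x.2 + y.2) ^+ 2.
    by move: xx yy; rewrite /dot; lra.
  rewrite -(@pmulr_rgt0 _ 2)// e2 lt_neqAle addr_ge0 ?sqr_ge0// andbT eq_sym.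
  rewrite paddr_eq0 ?sqr_ge0// !sqrf_eq0; apply/negP => /andP[/eqP e1 /eqP e3].
  apply/dneq/eq_direction => //; first exact: nesym.
  rewrite (unit_directionC iu) -/x -/y [RHS]surjective_pairing.
  by rewrite -[y.1](addKr x.1) e1 addr0 -[y.2](addKr x.2) e3 addr0.
exists (- (x + y)) => j ji; set q := unit_direction _ _.
rewrite dotNr oppr_lt0 dotC.
(* For j = u or j = w the dot product with x + y is exactly 1 + x . y. *)
have [ju|ju] := eqVneq j u.
  by rewrite /q ju -/x dotDl xx [dot y x]dotC.
have [jw|jw] := eqVneq j w.
  by rewrite /q jw -/y dotDl yy addrC.
apply: (lt_le_trans xy).
have ij : p i <> p j by apply/site_neq/nesym/eqP.
have H1 : \forall t \near 0^'+,
    cross (unit_difference (p i) (p w) t) (unit_difference (p i) (p j) t) < 0.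
  by apply: near_on_right_unit => //; apply: wr; exact/eqP.
have H2 : \forall t \near 0^'+,
    cross (unit_difference (p i) (p j) t) (unit_difference (p i) (p u) t) < 0.
  apply: near_on_right_unit => //; rewrite /on_right -orient_poly_rot.
  by apply: ur; exact/eqP.
(* If u = w, the third site [j] would lie strictly on both sides of the line through [p i] and
   [p u]. *)
have uw : u <> w.
  move=> uw; rewrite -uw in H1.
  have [t [h1 h2]] := filter_ex (F := 0^'+) (filterI (F := 0^'+) H1 H2).
  by move: h1 h2; rewrite /cross; lra.
have H3 : \forall t \near 0^'+,
    cross (unit_difference (p i) (p w) t) (unit_difference (p i) (p u) t) < 0.
  by apply: near_on_right_unit => //; apply: wr.
have Hu := near_dot_unit_difference iu; have Hw := near_dot_unit_difference ipw.
have Hj := near_dot_unit_difference ij.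
have cvg_dot v v' : p i <> v -> p i <> v' ->
    dot (unit_difference (p i) v t) (unit_difference (p i) v' t) @[t --> 0^'+] -->
    dot (unit_direction (p i) v) (unit_direction (p i) v').
  move=> iv iv'; apply: cvgD; apply: cvgM;
    by [exact: cvg_unit_difference1|exact: cvg_unit_difference2].
rewrite dotDl -subr_ge0.
pose x' := unit_difference (p i) (p u).
pose y' := unit_difference (p i) (p w).
pose q' := unit_difference (p i) (p j).
have c : dot (x' t) (q' t) + dot (y' t) (q' t) - (1 + dot (x' t) (y' t)) @[t --> 0^'+] -->
    dot x q + dot y q - (1 + dot x y).
  apply: cvgB; apply: cvgD;
    by [exact: cvg_dot|exact: cvg_cst].
apply: (cvgr_to_ge c); near=> t; rewrite subr_ge0 -dotDl.
by apply: dot_bisector_ge; near: t.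
Unshelve. all: by end_near. Qed.

End Corners.

Theorem lemma4p35 (R : realType) (n : nat) (hn : (2 <= n)%N)
    (p : 'I_n -> site R) (hp : zero_cluster p) (i : 'I_n) :
  (0 < area (voronoi_cell p i))%E <-> DH_vertices p i.
Proof.
case: hp => p_inj [gp _] p0.
(* All sites are at the origin at t = 0, so every midpoint vanishes and the cell becomes a cone. *)
have -> : voronoi_cell p i = \bigcap_(j in [set j | j != i])
    [set z | dot (unit_direction (p i) (p j)) z <= 0].
  have vhE j : vh p i j = [set z | dot (unit_direction (p i) (p j)) z <= 0].
    by rewrite /vh !p0 addr0 scaler0; under eq_set do rewrite subr0.
  rewrite /voronoi_cell; apply/seteqP; split => z h j /= ji.
    by have := h j (elimN eqP ji); rewrite vhE.
  by rewrite vhE; apply: h; exact/eqP.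
apply: iff_trans; first apply: (@area_cone_gt0P _ _ (fun j => j != i)).
  move=> j _; apply/negP => /eqP d0.
  have := dot_unit_direction (p i) (p j).
  by rewrite d0 /dot /= mulr0 addr0 => /eqP; rewrite eq_sym oner_eq0.
split=> [[z zneg]|].
  exact: corner_of_half_plane p_inj _ _ hn gp zneg.
exact: half_plane_of_corner.
Qed.
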